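(* Let $\dot{\bm{Y}}\in\mathbb{Q}^{m\times n}$ with $m\ge n$, let $\lambda>0$, and let $\dot{\bm{Y}}=\dot{\bm{U}}\bm{\Sigma}_{\dot{\bm{Y}}}\dot{\bm{V}}^*$ be a quaternion SVD of $\dot{\bm{Y}}$, with $\dot{\bm{U}}\in\mathbb{Q}^{m\times m}$, $\dot{\bm{V}}\in\mathbb{Q}^{n\times n}$ unitary and singular values $\sigma_{\dot{\bm{Y}},1}\ge\dots\ge\sigma_{\dot{\bm{Y}},n}\ge0$ on the diagonal of $\bm{\Sigma}_{\dot{\bm{Y}}}$. Consider the problem $$\min_{\dot{\bm{X}}\in\mathbb{Q}^{m\times n}}\ \frac12\|\dot{\bm{Y}}-\dot{\bm{X}}\|_F^2+\lambda\frac{\|\dot{\bm{X}}\|_*}{\|\dot{\bm{X}}\|_F}.$$ A global optimum of this problem is given by $\dot{\bm{X}}=\dot{\bm{U}}\tilde{\bm{\Sigma}}_{\dot{\bm{X}}}\dot{\bm{V}}^*$, where $\tilde{\bm{\Sigma}}_{\dot{\bm{X}}}$ is the $m\times n$ nonnegative diagonal matrix with diagonal $\tilde{\bm{\sigma}}=(\tilde\sigma_{1},\dots,\tilde\sigma_{n})$, and $\tilde{\bm{\sigma}}$ is a solution of the real vector problem $$\min_{\bm{\sigma}\in\mathbb{R}^n}\ \frac12\|\bm{\sigma}_{\dot{\bm{Y}}}-\bm{\sigma}\|_2^2+\lambda\frac{\|\bm{\sigma}\|_1}{\|\bm{\sigma}\|_2}\quad\text{s.t.}\quad \sigma_1\ge\sigma_2\ge\dots\ge\sigma_n\ge0,$$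 with $\bm{\sigma}_{\dot{\bm{Y}}}=(\sigma_{\dot{\bm{Y}},1},\dots,\sigma_{\dot{\bm{Y}},n})$.
   Context: $\mathbb{Q}$ denotes the real quaternion algebra with basis $1,\bm{i},\bm{j},\bm{k}$. ${}^*$ denotes conjugate transpose; a quaternion SVD of $\dot{\bm{Y}}$ is a factorization $\dot{\bm{Y}}=\dot{\bm{U}}\bm{\Sigma}\dot{\bm{V}}^*$ with $\dot{\bm{U}},\dot{\bm{V}}$ unitary quaternion matrices and $\bm{\Sigma}$ real, nonnegative, diagonal with descending diagonal entries (the singular values). The nuclear norm $\|\dot{\bm{X}}\|_*$ is the sum of the singular values and $\|\dot{\bm{X}}\|_F=\sqrt{\sum_{i,j}|\dot x_{ij}|^2}$ (the $\ell_2$ norm of the singular values); the objective is considered for nonzero $\dot{\bm{X}}$ (and nonzero $\bm{\sigma}$ in the vector problem). *)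

(* Defs.v *)
From HB Require Import structures.
From mathcomp Require Import all_boot all_order all_algebra.
From mathcomp Require Import reals.
From Stdlib Require Import ClassicalEpsilon.
Set Implicit Arguments. Unset Strict Implicit. Unset Printing Implicit Defensive.
Import Order.TTheory GRing.Theory Num.Theory.
Local Open Scope ring_scope.

(* A quaternion matrix X in Q^{m x n} is encoded by its four real components:
   X = X_r + X_i i + X_j j + X_k k with X_r, X_i, X_j, X_k real m x n matrices. *)
Record qmx (R : realType) (m n : nat) := QMx {
  qr : 'M[R]_(m, n); qi : 'M[R]_(m, n); qj : 'M[R]_(m, n); qk : 'M[R]_(m, n) }.

Section QMx.
Variable R : realType.

Definition qzero m n : qmx R m n := QMx 0 0 0 0.
Definition qid n : qmx R n n := QMx 1%:M 0 0 0.
Definition qreal m n (A : 'M[R]_(m, n)) : qmx R m n := QMx A 0 0 0.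

Definition qsub m n (A B : qmx R m n) : qmx R m n :=
  QMx (qr A - qr B) (qi A - qi B) (qj A - qj B) (qk A - qk B).

(* product, using the Hamilton rules i^2 = j^2 = k^2 = ijk = -1 *)
Definition qmul m n p (A : qmx R m n) (B : qmx R n p) : qmx R m p :=
  QMx (qr A *m qr B - qi A *m qi B - qj A *m qj B - qk A *m qk B)
      (qr A *m qi B + qi A *m qr B + qj A *m qk B - qk A *m qj B)
      (qr A *m qj B - qi A *m qk B + qj A *m qr B + qk A *m qi B)
      (qr A *m qk B + qi A *m qj B - qj A *m qi B + qk A *m qr B).

Definition qadj m n (A : qmx R m n) : qmx R n m :=
  QMx (qr A)^T (- (qi A)^T) (- (qj A)^T) (- (qk A)^T).

Definition qunitary n (U : qmx R n n) :=
  qmul U (qadj U) = qid n /\ qmul (qadj U) U = qid n.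

Definition diagmn m n (s : 'rV[R]_n) : 'M[R]_(m, n) :=
  \matrix_(i < m, j < n) (if nat_of_ord i == nat_of_ord j then s 0 j else 0).

Definition sdesc n (s : 'rV[R]_n) :=
  (forall i j : 'I_n, (i <= j)%N -> s 0 j <= s 0 i) /\ (forall i, 0 <= s 0 i).

(* X = U Sigma V^* is a quaternion SVD; s lists the diagonal of Sigma
   (entries with index >= m, which do not appear in Sigma, are forced to 0). *)
Definition qsvd m n (X : qmx R m n) (U : qmx R m m) (s : 'rV[R]_n)
    (V : qmx R n n) :=
  [/\ qunitary U, qunitary V, sdesc s,
      (forall j : 'I_n, (m <= j)%N -> s 0 j = 0) &
      X = qmul (qmul U (qreal (diagmn m s))) (qadj V)].

(* the singular values of X (taken from some SVD; they are unique) *)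
Definition qsvals m n (X : qmx R m n) : 'rV[R]_n :=
  epsilon (inhabits 0) (fun s => exists U V, qsvd X U s V).

Definition qnuc m n (X : qmx R m n) : R := \sum_j qsvals X 0 j.

Definition qfrob m n (X : qmx R m n) : R :=
  Num.sqrt (\sum_i \sum_j
    (qr X i j ^+ 2 + qi X i j ^+ 2 + qj X i j ^+ 2 + qk X i j ^+ 2)).

Definition qobj m n (Y : qmx R m n) (lam : R) (X : qmx R m n) : R :=
  2^-1 * qfrob (qsub Y X) ^+ 2 + lam * (qnuc X / qfrob X).

Definition vobj n (sY : 'rV[R]_n) (lam : R) (s : 'rV[R]_n) : R :=
  2^-1 * (\sum_j (sY 0 j - s 0 j) ^+ 2)
  + lam * ((\sum_j `|s 0 j|) / Num.sqrt (\sum_j s 0 j ^+ 2)).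

End QMx.

(* Main.v *)
From Stdlib Require Import ClassicalEpsilon.
Require Import Defs.
From HB Require Import structures.
From mathcomp Require Import all_boot all_order all_algebra.
From mathcomp Require Import all_classical reals topology normedtype derive.
From mathcomp Require Import ring lra.
Import Order.TTheory GRing.Theory Num.Theory.
Import numFieldNormedType.Exports.
Set Implicit Arguments. Unset Strict Implicit. Unset Printing Implicit Defensive.
Local Open Scope ring_scope.

(* Since |Y - Z|^2 = |Y|^2 - 2 Re <Y, Z> + |Z|^2 and the penalty of Z depends only on its singular
   values t, von Neumann's trace inequality Re <Y, Z> <= sum_i s_i t_i gives
   obj(Z) >= vobj(t) >= vobj(s) = obj(X).
   Trace inequality: with P = U^* W and N = Q^* V, Re <U S V^*, W T Q^*> is
   sum_ij s_i t_j Re(P_ij N_ji), which is at most sum_ij s_i t_j D_ij for the doubly substochastic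
   D_ij = (|P_ij|^2 + |N_ji|^2) / 2; two Abel summations conclude.
   Existence of a quaternion SVD: a unit vector v maximizing |Z v| and the direction of Z v are
   completed to unitary matrices by Householder reflections; maximality forces the block form
   diag(sigma, B), and one recurses on B. *)

(** * The quaternion ring over a real field: conjugation, squared norm, real part *)

Record quat (R : Type) := Quat { q0 : R; q1 : R; q2 : R; q3 : R }.

(** The round trip through nested pairs serves to transfer the choice structure from tuples to
    quaternions, on which the ring structure below is built. *)
Definition quat_prod (R : Type) (x : quat R) : R * R * R * R :=
  (q0 x, q1 x, q2 x, q3 x).
Definition prod_quat (R : Type) (x : R * R * R * R) : quat R :=
  Quat x.1.1.1 x.1.1.2 x.1.2 x.2.

Lemma quat_prodK (R : Type) : cancel (@quat_prod R) (@prod_quat R).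
Proof. by case. Qed.

HB.instance Definition _ (R : choiceType) :=
  Choice.copy (quat R) (can_type (@quat_prodK R)).

Section QuatRing.
Variable R : realFieldType.
Implicit Types x y z : quat R.

Lemma quatP x y :
  q0 x = q0 y -> q1 x = q1 y -> q2 x = q2 y -> q3 x = q3 y -> x = y.
Proof. by case: x => ????; case: y => ???? /= -> -> -> ->. Qed.

Definition quat_zero : quat R := Quat 0 0 0 0.
Definition quat_one : quat R := Quat 1 0 0 0.
Definition quat_add x y :=
  Quat (q0 x + q0 y) (q1 x + q1 y) (q2 x + q2 y) (q3 x + q3 y).
Definition quat_opp x := Quat (- q0 x) (- q1 x) (- q2 x) (- q3 x).
Definition quat_mul x y :=
  Quat (q0 x * q0 y - q1 x * q1 y - q2 x * q2 y - q3 x * q3 y)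
       (q0 x * q1 y + q1 x * q0 y + q2 x * q3 y - q3 x * q2 y)
       (q0 x * q2 y - q1 x * q3 y + q2 x * q0 y + q3 x * q1 y)
       (q0 x * q3 y + q1 x * q2 y - q2 x * q1 y + q3 x * q0 y).

Lemma quat_addA : associative quat_add.
Proof. by move=> x y z; apply: quatP => /=; ring. Qed.
Lemma quat_addC : commutative quat_add.
Proof. by move=> x y; apply: quatP => /=; ring. Qed.
Lemma quat_add0 : left_id quat_zero quat_add.
Proof. by move=> x; apply: quatP => /=; ring. Qed.
Lemma quat_addN : left_inverse quat_zero quat_opp quat_add.
Proof. by move=> x; apply: quatP => /=; ring. Qed.
HB.instance Definition _ := GRing.isZmodule.Build (quat R)
  quat_addA quat_addC quat_add0 quat_addN.

Lemma quat_mulA : associative quat_mul.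
Proof. by move=> x y z; apply: quatP => /=; ring. Qed.
Lemma quat_mul1l : left_id quat_one quat_mul.
Proof. by move=> x; apply: quatP => /=; ring. Qed.
Lemma quat_mul1r : right_id quat_one quat_mul.
Proof. by move=> x; apply: quatP => /=; ring. Qed.
Lemma quat_mulDl : left_distributive quat_mul quat_add.
Proof. by move=> x y z; apply: quatP => /=; ring. Qed.
Lemma quat_mulDr : right_distributive quat_mul quat_add.
Proof. by move=> x y z; apply: quatP => /=; ring. Qed.
Lemma quat_one_neq0 : quat_one != 0.
Proof. by apply/eqP=> /(congr1 (@q0 R))/eqP; rewrite oner_eq0. Qed.
HB.instance Definition _ := GRing.Zmodule_isNzRing.Build (quat R)
  quat_mulA quat_mul1l quat_mul1r quat_mulDl quat_mulDr quat_one_neq0.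

Lemma q0_additive : zmod_morphism (@q0 R). Proof. by []. Qed.
Lemma q1_additive : zmod_morphism (@q1 R). Proof. by []. Qed.
Lemma q2_additive : zmod_morphism (@q2 R). Proof. by []. Qed.
Lemma q3_additive : zmod_morphism (@q3 R). Proof. by []. Qed.
HB.instance Definition _ := GRing.isZmodMorphism.Build _ _ (@q0 R) q0_additive.
HB.instance Definition _ := GRing.isZmodMorphism.Build _ _ (@q1 R) q1_additive.
HB.instance Definition _ := GRing.isZmodMorphism.Build _ _ (@q2 R) q2_additive.
HB.instance Definition _ := GRing.isZmodMorphism.Build _ _ (@q3 R) q3_additive.

Definition qofr (a : R) : quat R := Quat a 0 0 0.
Definition qconj x := Quat (q0 x) (- q1 x) (- q2 x) (- q3 x).
Definition qdot x y := q0 x * q0 y + q1 x * q1 y + q2 x * q2 y + q3 x * q3 y.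
Definition qnorm2 x := qdot x x.

Lemma qofr_additive : zmod_morphism qofr.
Proof. by move=> x y; apply: quatP => //=; ring. Qed.
Lemma qofr_monoid : monoid_morphism qofr.
Proof. by split => // x y; apply: quatP => //=; ring. Qed.
HB.instance Definition _ := GRing.isZmodMorphism.Build _ _ qofr qofr_additive.
HB.instance Definition _ := GRing.isMonoidMorphism.Build _ _ qofr qofr_monoid.

Lemma qconj_additive : zmod_morphism qconj.
Proof. by move=> x y; apply: quatP => //=; ring. Qed.
HB.instance Definition _ := GRing.isZmodMorphism.Build _ _ qconj qconj_additive.

Lemma qconjM x y : qconj (x * y) = qconj y * qconj x.
Proof. by apply: quatP => /=; ring. Qed.
Lemma qconjK : involutive qconj.
Proof. by move=> x; apply: quatP => /=; ring. Qed.
Lemma qconj_ofr a : qconj (qofr a) = qofr a.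
Proof. by apply: quatP => /=; ring. Qed.
Lemma qofrC a x : qofr a * x = x * qofr a.
Proof. by apply: quatP => /=; ring. Qed.
Lemma q0_mulC x y : q0 (x * y) = q0 (y * x).
Proof. by move=> /=; ring. Qed.
Lemma q0_conjM x y : q0 (qconj x * y) = qdot x y.
Proof. by rewrite /qdot /=; ring. Qed.
Lemma q0_ofrM a x : q0 (qofr a * x) = a * q0 x.
Proof. by move=> /=; ring. Qed.
Lemma qconj_mul x : qconj x * x = qofr (qnorm2 x).
Proof. by rewrite /qnorm2 /qdot; apply: quatP => /=; ring. Qed.
Lemma qmul_conj x : x * qconj x = qofr (qnorm2 x).
Proof. by rewrite /qnorm2 /qdot; apply: quatP => /=; ring. Qed.
Lemma qnorm2_conj x : qnorm2 (qconj x) = qnorm2 x.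
Proof. by rewrite /qnorm2 /qdot /=; ring. Qed.
Lemma qnorm2_ofr a : qnorm2 (qofr a) = a ^+ 2.
Proof. by rewrite /qnorm2 /qdot /=; ring. Qed.
Lemma qnorm2M x y : qnorm2 (x * y) = qnorm2 x * qnorm2 y.
Proof. by rewrite /qnorm2 /qdot /=; ring. Qed.
Lemma qnorm2_ge0 x : 0 <= qnorm2 x.
Proof. by rewrite /qnorm2 /qdot -!expr2 !addr_ge0 // sqr_ge0. Qed.
Lemma qnorm2_eq0 x : qnorm2 x = 0 -> x = 0.
Proof.
move/eqP; rewrite /qnorm2 /qdot -!expr2 !paddr_eq0 ?addr_ge0 ?sqr_ge0 //.
by rewrite !sqrf_eq0 => /andP[/andP[/andP[/eqP ? /eqP ?] /eqP ?] /eqP ?]; apply: quatP.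
Qed.
(** Since Re(xy) is the real inner product of the conjugate of x with y, the gap between the two
    sides is half of a squared distance. This is the source of the averages D_ij in the trace
    inequality. *)
Lemma q0M_le x y : q0 (x * y) <= 2^-1 * (qnorm2 x + qnorm2 y).
Proof.
rewrite -subr_ge0.
suff -> : 2^-1 * (qnorm2 x + qnorm2 y) - q0 (x * y) = 2^-1 * qnorm2 (qconj x - y).
  by rewrite mulr_ge0 ?qnorm2_ge0 // invr_ge0.
by rewrite /qnorm2 /qdot /=; field.
Qed.

End QuatRing.

(** * Quaternion matrices: adjoint, real inner product, unitary and diagonal matrices *)

Section QuatMatrix.
Variable R : realFieldType.
Local Notation H := (quat R).

Definition adjmx m n (A : 'M[H]_(m, n)) : 'M[H]_(n, m) :=
  \matrix_(i, j) qconj (A j i).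
(** This is Re tr(A^* B), as [ipmx_tr] shows; accordingly [frmx] is the squared Frobenius norm. *)
Definition ipmx m n (A B : 'M[H]_(m, n)) : R :=
  \sum_i \sum_j qdot (A i j) (B i j).
Definition frmx m n (A : 'M[H]_(m, n)) : R := ipmx A A.
Definition unimx n (U : 'M[H]_n) :=
  U *m adjmx U = 1%:M /\ adjmx U *m U = 1%:M.
Definition diagq m n (s : 'rV[R]_n) : 'M[H]_(m, n) :=
  \matrix_(i < m, j < n) (if nat_of_ord i == nat_of_ord j then qofr (s 0 j) else 0).

Lemma adjmxM m n p (A : 'M[H]_(m, n)) (B : 'M[H]_(n, p)) :
  adjmx (A *m B) = adjmx B *m adjmx A.
Proof.
apply/matrixP => i j; rewrite !mxE raddf_sum.
by apply: eq_bigr => k _; rewrite !mxE /= qconjM.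
Qed.

Lemma adjmxK m n (A : 'M[H]_(m, n)) : adjmx (adjmx A) = A.
Proof. by apply/matrixP => i j; rewrite !mxE qconjK. Qed.

Lemma adjmxB m n (A B : 'M[H]_(m, n)) : adjmx (A - B) = adjmx A - adjmx B.
Proof. by apply/matrixP => i j; rewrite !mxE raddfB. Qed.

Lemma adjmx0 m n : adjmx 0 = 0 :> 'M[H]_(m, n).
Proof. by apply/matrixP => i j; rewrite !mxE raddf0. Qed.

Lemma adjmxN m n (A : 'M[H]_(m, n)) : adjmx (- A) = - adjmx A.
Proof. by apply/matrixP => i j; rewrite !mxE raddfN. Qed.

Lemma adjmx_scalar n a : adjmx (qofr a)%:M = (qofr a)%:M :> 'M[H]_n.
Proof.
by apply/matrixP => i j; rewrite !mxE eq_sym raddfMn /= qconj_ofr.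
Qed.

Lemma adjmx1 n : adjmx 1%:M = 1%:M :> 'M[H]_n.
Proof. by rewrite -[1]/(qofr 1) adjmx_scalar. Qed.

Lemma adjmx_block m1 m2 n1 n2 (A : 'M[H]_(m1, n1)) B C (D : 'M[H]_(m2, n2)) :
  adjmx (block_mx A B C D) = block_mx (adjmx A) (adjmx C) (adjmx B) (adjmx D).
Proof.
apply/matrixP => i j; rewrite mxE.
by case: (split_ordP i) => i' ->; case: (split_ordP j) => j' ->;
  rewrite ?block_mxEul ?block_mxEur ?block_mxEdl ?block_mxEdr mxE.
Qed.

Lemma ipmx_tr m n (A B : 'M[H]_(m, n)) : ipmx A B = q0 (\tr (adjmx A *m B)).
Proof.
rewrite /ipmx /mxtrace exchange_big raddf_sum; apply: eq_bigr => j _ /=.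
by rewrite !mxE raddf_sum; apply: eq_bigr => i _; rewrite mxE -q0_conjM.
Qed.

Lemma ipmxC m n (A B : 'M[H]_(m, n)) : ipmx A B = ipmx B A.
Proof. by apply: eq_bigr => i _; apply: eq_bigr => j _; rewrite /qdot; ring. Qed.

(** Over a noncommutative ring the trace need not be cyclic; its real part still is, because Re(xy)
    = Re(yx). This lets right factors move across [ipmx]. *)
Lemma q0_mxtraceC m n (A : 'M[H]_(m, n)) (B : 'M[H]_(n, m)) :
  q0 (\tr (A *m B)) = q0 (\tr (B *m A)).
Proof.
rewrite /mxtrace !raddf_sum /=.
under eq_bigr do rewrite mxE raddf_sum.
under [RHS]eq_bigr do rewrite mxE raddf_sum.
by rewrite exchange_big /=; apply: eq_bigr => i _; apply: eq_bigr => j _; exact: q0_mulC.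
Qed.

Lemma ipmx_mull m n p (U : 'M[H]_(m, n)) (A : 'M[H]_(n, p)) B :
  ipmx (U *m A) B = ipmx A (adjmx U *m B).
Proof. by rewrite !ipmx_tr adjmxM mulmxA. Qed.

Lemma ipmx_mulr m n p (A : 'M[H]_(m, n)) (V : 'M[H]_(n, p)) B :
  ipmx (A *m V) B = ipmx A (B *m adjmx V).
Proof. by rewrite !ipmx_tr adjmxM -mulmxA q0_mxtraceC mulmxA. Qed.

Lemma frmx_mull n p (U : 'M[H]_n) (A : 'M[H]_(n, p)) :
  unimx U -> frmx (U *m A) = frmx A.
Proof. by case=> _ UU; rewrite /frmx ipmx_mull mulmxA UU mul1mx. Qed.

Lemma frmx_mulr n p (A : 'M[H]_(p, n)) (U : 'M[H]_n) :
  unimx U -> frmx (A *m U) = frmx A.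
Proof. by case=> UU _; rewrite /frmx ipmx_mulr -mulmxA UU mulmx1. Qed.

Lemma frmxB m n (A B : 'M[H]_(m, n)) :
  frmx (A - B) = frmx A - 2 * ipmx A B + frmx B.
Proof.
rewrite /frmx /ipmx mulr_sumr -sumrB -big_split; apply: eq_bigr => i _ /=.
rewrite mulr_sumr -sumrB -big_split; apply: eq_bigr => j _ /=.
by rewrite !mxE /qdot /=; ring.
Qed.

Lemma frmx_ge0 m n (A : 'M[H]_(m, n)) : 0 <= frmx A.
Proof. by apply: sumr_ge0 => i _; apply: sumr_ge0 => j _; exact: qnorm2_ge0. Qed.

Lemma frmx_eq0 m n (A : 'M[H]_(m, n)) : frmx A = 0 -> A = 0.
Proof.
move=> /eqP; rewrite psumr_eq0 => [/allP A0|i _]; last first.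
  by apply: sumr_ge0 => j _; exact: qnorm2_ge0.
apply/matrixP => i j; rewrite mxE; apply: qnorm2_eq0.
have := A0 i (mem_index_enum _); rewrite psumr_eq0 => [/allP Ai|? _]; last exact: qnorm2_ge0.
exact/eqP/(Ai j (mem_index_enum _)).
Qed.

Lemma frmx0 m n : frmx (0 : 'M[H]_(m, n)) = 0.
Proof.
by rewrite /frmx /ipmx big1 // => i _; rewrite big1 // => j _; rewrite !mxE /qdot /= !mulr0 !addr0.
Qed.

Lemma frmx_real_scale m n a (A : 'M[H]_(m, n)) : frmx (qofr a *: A) = a ^+ 2 * frmx A.
Proof.
rewrite /frmx /ipmx mulr_sumr; apply: eq_bigr => i _; rewrite mulr_sumr.
by apply: eq_bigr => j _; rewrite !mxE -/(qnorm2 _) qnorm2M qnorm2_ofr.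
Qed.

Lemma frmx_adj m n (A : 'M[H]_(m, n)) : frmx (adjmx A) = frmx A.
Proof.
rewrite /frmx /ipmx exchange_big; apply: eq_bigr => i _; apply: eq_bigr => j _.
by rewrite !mxE; exact: qnorm2_conj.
Qed.

Lemma frmx_scalar1 (q : H) : frmx (q%:M : 'M_1) = qnorm2 q.
Proof. by rewrite /frmx /ipmx !big_ord1 !mxE. Qed.

Lemma delta_mx_col0 n : delta_mx 0 0 = col_mx 1%:M 0 :> 'M[H]_(1 + n, 1).
Proof.
apply/matrixP => i j; rewrite !ord1; case: (split_ordP i) => k ->.
  by rewrite col_mxEu !ord1 !mxE.
by rewrite col_mxEd !mxE.
Qed.

Lemma frmx_delta m n (i : 'I_m) (j : 'I_n) : frmx (delta_mx i j) = 1.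
Proof.
have d0 k l : (k, l) != (i, j) -> qdot (delta_mx i j k l : H) (delta_mx i j k l) = 0.
  by move=> /negPf kl; rewrite mxE -[_ && _]/((k, l) == (i, j)) kl -/(qnorm2 _)
    -[0%:R]/(qofr 0) qnorm2_ofr expr0n.
rewrite /frmx /ipmx (bigD1 i) //= (bigD1 j) //= big1 => [|l lj]; last first.
  by rewrite d0 // xpair_eqE eqxx.
rewrite big1 => [|k ki]; last by rewrite big1 // => l _; rewrite d0 // xpair_eqE (negPf ki).
by rewrite mxE !eqxx !addr0 -[_%:R]/(qofr 1) -/(qnorm2 _) qnorm2_ofr expr1n.
Qed.

Lemma frmx_col m1 m2 n (A : 'M[H]_(m1, n)) (B : 'M[H]_(m2, n)) :
  frmx (col_mx A B) = frmx A + frmx B.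
Proof.
rewrite /frmx /ipmx big_split_ord; congr (_ + _); apply: eq_bigr => i _;
  by apply: eq_bigr => j _; rewrite ?col_mxEu ?col_mxEd.
Qed.

Lemma adjmx_mul_cV n (v : 'cV[H]_n) : adjmx v *m v = (qofr (frmx v))%:M.
Proof.
apply/matrixP => i j; rewrite !ord1 !mxE /frmx /ipmx raddf_sum.
by apply: eq_bigr => k _; rewrite big_ord1 mxE qconj_mul.
Qed.

Lemma mul_adjmx_rV n (v : 'rV[H]_n) : v *m adjmx v = (qofr (frmx v))%:M.
Proof. by rewrite -{1}(adjmxK v) adjmx_mul_cV frmx_adj. Qed.

(** Scaling multiplies entries on the left, so the scalar has to cross the entries of [A]; it can
    because real quaternions are central. *)
Lemma scale_qofr_mulr m n p a (A : 'M[H]_(m, n)) (B : 'M[H]_(n, p)) :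
  A *m (qofr a *: B) = qofr a *: (A *m B).
Proof.
apply/matrixP => i j; rewrite !mxE mulr_sumr; apply: eq_bigr => k _.
by rewrite !mxE !mulrA qofrC.
Qed.

Lemma mul_mx_qofr m n a (A : 'M[H]_(m, n)) : A *m (qofr a)%:M = qofr a *: A.
Proof. by rewrite -[_%:M]mulmx1 mul_scalar_mx scale_qofr_mulr mulmx1. Qed.

Lemma unimxM n (U V : 'M[H]_n) : unimx U -> unimx V -> unimx (U *m V).
Proof.
move=> [U1 U2] [V1 V2]; split; rewrite adjmxM.
  by rewrite mulmxA -(mulmxA U) V1 mulmx1.
by rewrite mulmxA -(mulmxA (adjmx V)) U2 mulmx1.
Qed.

Lemma unimx_adj n (U : 'M[H]_n) : unimx U -> unimx (adjmx U).
Proof. by case=> ? ?; split; rewrite adjmxK. Qed.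

Lemma unimx1 n : unimx (1%:M : 'M[H]_n).
Proof. by split; rewrite adjmx1 mulmx1. Qed.

Lemma unimx_block n1 n2 (A : 'M[H]_n1) (D : 'M[H]_n2) :
  unimx A -> unimx D -> unimx (block_mx A 0 0 D).
Proof.
move=> [A1 A2] [D1 D2]; split;
  by rewrite adjmx_block mulmx_block !adjmx0 !mulmx0 !mul0mx !addr0 !add0r
    ?A1 ?A2 ?D1 ?D2 -scalar_mx_block.
Qed.

Lemma unimx_row n (U : 'M[H]_n) i : unimx U -> \sum_j qnorm2 (U i j) = 1.
Proof.
case=> /matrixP/(_ i i); rewrite !mxE eqxx => UU _.
rewrite -[RHS]/(q0 (1%:R : H)) -UU raddf_sum.
by apply: eq_bigr => j _; rewrite mxE qmul_conj.
Qed.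

Lemma unimx_col n (U : 'M[H]_n) j : unimx U -> \sum_i qnorm2 (U i j) = 1.
Proof.
move/unimx_adj/(unimx_row j) => <-.
by apply: eq_bigr => i _; rewrite mxE qnorm2_conj.
Qed.

Lemma diagqB m n (s t : 'rV[R]_n) : diagq m (s - t) = diagq m s - diagq m t.
Proof. by apply/matrixP => i j; rewrite !mxE; case: ifP; rewrite ?raddfB ?subr0. Qed.

Section Diag.
Variables (m n : nat) (le_nm : (n <= m)%N).
Local Notation w := (widen_ord le_nm).

Lemma diagqE (s : 'rV[R]_n) (i : 'I_m) (j : 'I_n) :
  diagq m s i j = if i == w j then qofr (s 0 j) else 0 :> H.
Proof. by rewrite mxE. Qed.

Lemma ipmx_diag (s : 'rV[R]_n) (M : 'M[H]_(m, n)) :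
  ipmx (diagq m s) M = \sum_j s 0 j * q0 (M (w j) j).
Proof.
rewrite /ipmx exchange_big; apply: eq_bigr => j _ /=.
rewrite (bigD1 (w j)) //= big1 => [|i /negPf ij]; rewrite diagqE ?eqxx ?ij /qdot /=.
  by ring.
by ring.
Qed.

Lemma frmx_diag (s : 'rV[R]_n) : frmx (diagq m s) = \sum_j s 0 j ^+ 2.
Proof. by rewrite /frmx ipmx_diag; apply: eq_bigr => j _; rewrite diagqE eqxx. Qed.

Lemma mulmx_diagq p (s : 'rV[R]_n) (P : 'M[H]_(p, m)) i (j : 'I_n) :
  (P *m diagq m s) i j = P i (w j) * qofr (s 0 j).
Proof.
rewrite mxE (bigD1 (w j)) //= big1 => [|k /negPf kj]; rewrite diagqE ?eqxx ?kj ?mulr0 //.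
by rewrite addr0.
Qed.

Lemma sum_widen_le (F : 'I_m -> R) : (forall i, 0 <= F i) ->
  \sum_(j < n) F (w j) <= \sum_i F i.
Proof.
move=> F0; rewrite -(big_ord_narrow le_nm) [leRHS](bigID (fun i : 'I_m => (i < n)%N)) /=.
by rewrite lerDl sumr_ge0.
Qed.
End Diag.

(** * Abel summation, doubly substochastic matrices and von Neumann's trace inequality *)

Lemma abel_ge0 (f c : nat -> R) n :
  (forall k, (k.+1 < n)%N -> f k.+1 <= f k) -> (forall k, (k < n)%N -> 0 <= f k) ->
  (forall k, (k <= n)%N -> 0 <= \sum_(i < k) c i) ->
  0 <= \sum_(i < n) f i * c i.
Proof.
case: n => [|n] fd f0 c0; first by rewrite big_ord0.
(* Each partial sum of [f i * c i] is at least the last weight times the partial sum of [c]. In the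
   induction step the earlier partial sum of [c] is nonnegative, so replacing its weight by the
   next, smaller one only decreases the bound. *)
suff /(_ n (leqnn _)) fc k : (k <= n)%N ->
    f k * \sum_(i < k.+1) c i <= \sum_(i < k.+1) f i * c i.
  by apply: le_trans fc; rewrite mulr_ge0 // ?f0 ?c0.
elim: k => [|k IH] kn; first by rewrite !big_ord1.
rewrite big_ord_recr [leRHS]big_ord_recr /= mulrDr lerD2r.
by apply: le_trans (IH (ltnW kn)); rewrite ler_wpM2r ?c0 ?fd // ltnW.
Qed.

Lemma abel_ord_ge0 n (s c : 'I_n -> R) :
  (forall i j : 'I_n, (i <= j)%N -> s j <= s i) -> (forall i, 0 <= s i) ->
  (forall k, 0 <= \sum_(i < n | (i < k)%N) c i) -> 0 <= \sum_i s i * c i.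
Proof.
move=> sd s0 c0.
(* Extension from ordinals to all naturals; the default value 0 is never read, as every index that
   occurs is below n. *)
pose ext (g : 'I_n -> R) i := if insub i is Some j then g j else 0.
have extE g (i : 'I_n) : ext g i = g i by rewrite /ext valK.
have extO g i (lt_in : (i < n)%N) : ext g i = g (Ordinal lt_in) by rewrite -extE.
have -> : \sum_i s i * c i = \sum_(i < n) ext s i * ext c i.
  by apply: eq_bigr => i _; rewrite !extE.
apply: abel_ge0 => k kn.
- by rewrite (extO _ _ kn) (extO _ _ (ltnW kn)) sd.
- by rewrite (extO _ _ kn).
- by rewrite (big_ord_widen _ _ kn); under eq_bigr do rewrite extE; exact: c0.
Qed.

(** One Abel summation in [s] and one in [t] reduce the claim to indicator sequences of initial
    segments of lengths k and l. There it says that the k by l corner of [D] has no larger sum than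
    the number of diagonal positions in it. *)
Lemma substochastic_le n (s t : 'I_n -> R) (D : 'I_n -> 'I_n -> R) :
  (forall i j : 'I_n, (i <= j)%N -> s j <= s i) -> (forall i, 0 <= s i) ->
  (forall i j : 'I_n, (i <= j)%N -> t j <= t i) -> (forall i, 0 <= t i) ->
  (forall i j, 0 <= D i j) -> (forall i, \sum_j D i j <= 1) ->
  (forall j, \sum_i D i j <= 1) ->
  \sum_i \sum_j s i * t j * D i j <= \sum_i s i * t i.
Proof.
move=> sd s0 td t0 D0 Dr Dc; rewrite -subr_ge0 -sumrB.
have -> : \sum_i (s i * t i - \sum_j s i * t j * D i j) =
    \sum_i s i * (t i - \sum_j t j * D i j).
  apply: eq_bigr => i _; rewrite mulrBr mulr_sumr; congr (_ - _).
  by apply: eq_bigr => j _; rewrite mulrA.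
apply: abel_ord_ge0 => // k.
have -> : \sum_(i < n | (i < k)%N) (t i - \sum_j t j * D i j) =
    \sum_j t j * ((j < k)%N%:R - \sum_(i < n | (i < k)%N) D i j).
  rewrite sumrB exchange_big /= big_mkcond -sumrB; apply: eq_bigr => j _.
  by rewrite mulrBr mulr_sumr; case: ifP; rewrite ?mulr1 ?mulr0.
apply: abel_ord_ge0 => // l; rewrite sumrB subr_ge0.
(* If l <= k, each of the l columns of the corner sums to at most 1; otherwise each of its k rows
   does. *)
case: (leqP l k) => lk.
  apply: ler_sum => j jl; rewrite (leq_trans jl lk); apply: le_trans (Dc j).
  by rewrite [leRHS](bigID (fun i : 'I_n => (i < k)%N)) /= lerDl sumr_ge0.
rewrite exchange_big /= [leRHS](bigID (fun i : 'I_n => (i < k)%N)) /=.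
rewrite -[leLHS]addr0 lerD ?sumr_ge0 //.
rewrite [leRHS](eq_bigl (fun i : 'I_n => (i < k)%N)) => [|i]; last first.
  by rewrite andb_idl // => /ltn_trans; apply.
apply: ler_sum => i ik; rewrite ik; apply: le_trans (Dr i).
by rewrite [leRHS](bigID (fun j : 'I_n => (j < l)%N)) /= lerDl sumr_ge0.
Qed.

Lemma von_neumann_le m n (U : 'M[H]_m) (V : 'M[H]_n) (W : 'M[H]_m) (Q : 'M[H]_n)
    (s t : 'rV[R]_n) : (n <= m)%N ->
  unimx U -> unimx V -> unimx W -> unimx Q ->
  (forall i j : 'I_n, (i <= j)%N -> s 0 j <= s 0 i) -> (forall i, 0 <= s 0 i) ->
  (forall i j : 'I_n, (i <= j)%N -> t 0 j <= t 0 i) -> (forall i, 0 <= t 0 i) ->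
  ipmx (U *m diagq m s *m adjmx V) (W *m diagq m t *m adjmx Q) <= \sum_j s 0 j * t 0 j.
Proof.
move=> le_nm uU uV uW uQ sd s0 td t0.
pose w := widen_ord le_nm.
pose P := adjmx U *m W; pose T := adjmx Q *m V.
have uP : unimx P by apply: unimxM => //; exact: unimx_adj.
have uT : unimx T by apply: unimxM => //; exact: unimx_adj.
rewrite ipmx_mulr ipmx_mull adjmxK.
have -> : adjmx U *m (W *m diagq m t *m adjmx Q *m V) = P *m diagq m t *m T.
  by rewrite /P /T !mulmxA.
rewrite (ipmx_diag le_nm).
(* Rows and columns of [T] have squared norm exactly 1, but [P] is m by m and only its leading n by
   n block enters. Its truncated row and column sums are at most 1, so [D] is substochastic rather
   than stochastic. *)
pose D i j := 2^-1 * (qnorm2 (P (w i) (w j)) + qnorm2 (T j i)).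
apply: (@le_trans _ _ (\sum_i \sum_j s 0 i * t 0 j * D i j)).
  apply: ler_sum => i _; rewrite mxE raddf_sum mulr_sumr; apply: ler_sum => j _.
  (* The real factor t_j sits between an entry of [P] and one of [T]; centrality brings it to the
     front, leaving the real part of a product of two quaternions. *)
  rewrite (mulmx_diagq le_nm) -qofrC -mulrA [X in _ * X]q0_ofrM mulrA.
  by rewrite ler_wpM2l ?mulr_ge0 // q0M_le.
have half_le (x y : R) : x <= 1 -> y <= 1 -> 2^-1 * (x + y) <= 1 by lra.
apply: (@substochastic_le _ (fun i => s 0 i) (fun j => t 0 j)) => // [i j|i|j].
- by rewrite mulr_ge0 ?invr_ge0 // addr_ge0 // qnorm2_ge0.
- rewrite -mulr_sumr big_split /= half_le //.
    rewrite -(unimx_row (w i) uP).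
    by apply: (sum_widen_le le_nm (F := fun j => qnorm2 (P (w i) j))) => ?; exact: qnorm2_ge0.
  by rewrite (unimx_col i uT).
- rewrite -mulr_sumr big_split /= half_le //.
    rewrite -(unimx_col (w j) uP).
    by apply: (sum_widen_le le_nm (F := fun i => qnorm2 (P i (w j)))) => ?; exact: qnorm2_ge0.
  by rewrite (unimx_row j uT).
Qed.

End QuatMatrix.

(** * Householder reflections and completion of a unit vector to a unitary matrix *)

Section Householder.
Variable R : rcfType.
Local Notation H := (quat R).

Lemma quat_polar (x : H) : exists2 u : H, qnorm2 u = 1 & x = qofr (Num.sqrt (qnorm2 x)) * u.
Proof.
case: (eqVneq x 0) => [->|x0].
  exists 1; first by rewrite /qnorm2 /qdot /=; ring.
  have -> : qnorm2 (0 : H) = 0 by rewrite /qnorm2 /qdot /=; ring.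
  by rewrite sqrtr0 raddf0 mul0r.
have nx0 : 0 < qnorm2 x.
  by rewrite lt_def qnorm2_ge0 andbT; apply: contra_neq x0; exact: qnorm2_eq0.
have s0 : Num.sqrt (qnorm2 x) != 0 by rewrite sqrtr_eq0 -ltNge.
exists (qofr (Num.sqrt (qnorm2 x))^-1 * x).
  by rewrite qnorm2M qnorm2_ofr exprVn sqr_sqrtr ?ltW // mulVf // gt_eqF.
by rewrite mulrA -rmorphM mulfV // rmorph1 mul1r.
Qed.

(** The reflection is self-adjoint because its coefficient is real. It is an involution because P =
    w w^* satisfies P P = |w|^2 P, so that with c = 2 / |w|^2 the terms -2cP and c^2 P P cancel. *)
Lemma householder_unimx n (w : 'cV[H]_n) : frmx w != 0 ->
  unimx (1%:M - qofr (2 / frmx w) *: (w *m adjmx w)).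
Proof.
move=> w0; set c := 2 / frmx w; set P := w *m adjmx w.
have aP : adjmx (1%:M - qofr c *: P) = 1%:M - qofr c *: P.
  by rewrite adjmxB adjmx1 -mul_scalar_mx adjmxM adjmx_scalar mul_mx_qofr
    adjmxM adjmxK mul_scalar_mx.
have PP : P *m P = qofr (frmx w) *: P.
  by rewrite /P mulmxA -(mulmxA w) adjmx_mul_cV mul_mx_qofr scalemxAl.
suff QQ : (1%:M - qofr c *: P) *m (1%:M - qofr c *: P) = 1%:M by split; rewrite aP.
rewrite mulmxBl mul1mx mulmxBr mulmx1 scale_qofr_mulr -scalemxAl PP.
rewrite !scalerA -!rmorphM /=.
have -> : qofr (c * c * frmx w) = qofr c + qofr c.
  by rewrite -raddfD; congr qofr; rewrite /c; field.
by rewrite scalerDl opprB addrK subrK.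
Qed.

(* The reflection in e_0 + v q^-1 exchanges e_0 with -(v q^-1), where v_0 = |v_0| q; adding
   rather than subtracting keeps the reflected vector nonzero. *)
Lemma unimx_with_col0 n (v : 'cV[H]_n.+1) : frmx v = 1 ->
  exists2 P : 'M[H]_n.+1, unimx P & P *m delta_mx 0 0 = v.
Proof.
move=> v1; have [q q1 vq] := quat_polar (v 0 0).
pose e : 'cV[H]_n.+1 := delta_mx 0 0.
pose v' := v *m (qconj q)%:M; set a := Num.sqrt _ in vq.
have qq : q * qconj q = 1 by rewrite qmul_conj q1 rmorph1.
have qq' : qconj q * q = 1 by rewrite qconj_mul q1 rmorph1.
have uq : unimx (q%:M : 'M_1).
  by split; apply/matrixP => i j; rewrite !mxE big_ord1 !mxE !ord1 /= ?qq ?qq'.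
have v'v : v' *m q%:M = v by rewrite -mulmxA -scalar_mxM qq' mulmx1.
have v'1 : frmx v' = 1 by rewrite -v1 -v'v (frmx_mulr v' uq).
have ecol : e = col_mx (1%:M : 'M_1) (0 : 'M_(n, 1)) by exact: delta_mx_col0.
have e1 : frmx e = 1 by exact: frmx_delta.
have v'0 : v' 0 0 = qofr a.
  by rewrite mxE big_ord1 !mxE mulr1n vq -mulrA qq mulr1.
have ev' : adjmx v' *m e = (qofr a)%:M.
  apply/matrixP => i j; rewrite !ord1 [LHS]mxE (bigD1 0) //= big1 => [|k /negPf k0].
    by rewrite [adjmx _ _ _]mxE v'0 qconj_ofr !mxE mulr1 addr0.
  by rewrite [e _ _]mxE k0 mulr0.
pose w := e + v'.
(* Because the first entry of [v'] is the real number [a], w^* e is real and equals half of |w|^2.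
   This is exactly the relation under which the reflection sends [e] to [e - w], that is, to
   [- v']. *)
have we : adjmx w *m e = (qofr (1 + a))%:M.
  have -> : w = e - - v' by rewrite opprK.
  rewrite adjmxB mulmxBl adjmx_mul_cV e1.
  by rewrite adjmxN mulNmx opprK ev' -raddfD -raddfD.
have fw : frmx w = 2 * (1 + a).
  have -> : frmx w = q0 (\tr (adjmx w *m e)) + q0 (\tr (adjmx w *m v')).
    by rewrite /frmx ipmx_tr {2}/w mulmxDr mxtraceD.
  rewrite we mxtrace_scalar mulr1n.
  rewrite -(ipmx_tr w v') ipmxC ipmx_tr.
  rewrite mulmxDr ev' adjmx_mul_cV v'1 mxtraceD !mxtrace_scalar !mulr1n /=; ring.
have a0 : 0 <= a by exact: sqrtr_ge0.
have w0 : frmx w != 0 by rewrite fw mulf_neq0 // gt_eqF //; lra.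
have He : (1%:M - qofr (2 / frmx w) *: (w *m adjmx w)) *m e = - v'.
  rewrite mulmxBl mul1mx -scalemxAl -mulmxA we mul_mx_qofr scalerA -rmorphM /=.
  have -> : 2 / frmx w * (1 + a) = 1 by rewrite fw; field; lra.
  by rewrite rmorph1 scale1r opprD addrA subrr add0r.
(* On [e], left multiplication by [D] is right multiplication by -q. Composed with the reflection it
   gives (-v')(-q) = v' q = v, which undoes both the sign and the normalization of the phase. *)
pose D : 'M[H]_(1 + n) := block_mx (- q)%:M 0 0 1%:M.
have uD : unimx D.
  apply: unimx_block; last exact: unimx1.
  by split; apply/matrixP => i j; rewrite !mxE big_ord1 !mxE !ord1 /= raddfN mulrNN ?qq ?qq'.
have De : D *m e = e *m (- q)%:M.
  by rewrite ecol (@mul_block_col _ 1 n 1 n) (@mul_col_mx _ 1 n)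
    !mulmx1 !mulmx0 !mul0mx !addr0 mul1mx.
exists ((1%:M - qofr (2 / frmx w) *: (w *m adjmx w)) *m D).
  exact: unimxM (householder_unimx w0) uD.
by rewrite -mulmxA De mulmxA He raddfN /= mulmxN mulNmx opprK.
Qed.

End Householder.

(** * A unit vector maximizing |Z v|, by compactness of the sphere *)

Section MaximalStretch.
Variable R : realType.
Local Notation H := (quat R).

Lemma continuous_sum (T : topologicalType) (I : finType) (F : I -> T -> R) :
  (forall i, continuous (F i)) -> continuous (fun x => \sum_i F i x).
Proof. by move=> cF; apply: continuous_big => //; exact: add_continuous. Qed.

(** Continuity is expressed through the four real components, so that the quaternions need no
    topology of their own. *)
Definition quat_continuous (T : topologicalType) (f : T -> H) :=
  [/\ continuous (@q0 R \o f), continuous (@q1 R \o f),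
      continuous (@q2 R \o f) & continuous (@q3 R \o f)].

Lemma quat_continuous_sum (T : topologicalType) (I : finType) (F : I -> T -> H) :
  (forall i, quat_continuous (F i)) -> quat_continuous (fun x => \sum_i F i x).
Proof.
move=> cF; split.
- have -> : @q0 R \o (fun x => \sum_i F i x) = fun x => \sum_i q0 (F i x).
    by apply/funext => x /=; rewrite raddf_sum.
  by apply: continuous_sum => i; case: (cF i).
- have -> : @q1 R \o (fun x => \sum_i F i x) = fun x => \sum_i q1 (F i x).
    by apply/funext => x /=; rewrite raddf_sum.
  by apply: continuous_sum => i; case: (cF i).
- have -> : @q2 R \o (fun x => \sum_i F i x) = fun x => \sum_i q2 (F i x).
    by apply/funext => x /=; rewrite raddf_sum.
  by apply: continuous_sum => i; case: (cF i).
- have -> : @q3 R \o (fun x => \sum_i F i x) = fun x => \sum_i q3 (F i x).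
    by apply/funext => x /=; rewrite raddf_sum.
  by apply: continuous_sum => i; case: (cF i).
Qed.

Lemma quat_continuous_mull (T : topologicalType) (a : H) (f : T -> H) :
  quat_continuous f -> quat_continuous (fun x => a * f x).
Proof.
case=> c0 c1 c2 c3.
have cM b (g : T -> R) : continuous g -> continuous (fun x => b * g x).
  by move=> cg x; apply: cvgM; [exact: cvg_cst | exact: cg].
split => x; rewrite /comp /=.
- by apply: cvgB; [apply: cvgB; [apply: cvgB |]|]; exact: cM.
- by apply: cvgB; [apply: cvgD; [apply: cvgD |]|]; exact: cM.
- by apply: cvgD; [apply: cvgD; [apply: cvgB |]|]; exact: cM.
- by apply: cvgD; [apply: cvgB; [apply: cvgD |]|]; exact: cM.
Qed.

Lemma qnorm2_continuous (T : topologicalType) (f : T -> H) :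
  quat_continuous f -> continuous (fun x => qnorm2 (f x)).
Proof.
by case=> c0 c1 c2 c3 x; rewrite /qnorm2 /qdot; apply: cvgD; [apply: cvgD; [apply: cvgD |]|];
  apply: cvgM; first [exact: c0|exact: c1|exact: c2|exact: c3].
Qed.

(** Coordinates identifying H^n with R^(4n), where closed bounded sets are compact and the extreme
    value theorem applies. *)
Definition cV_of_real n (x : 'rV[R]_(4 * n)) : 'cV[H]_n :=
  \col_i Quat (vec_mx x 0 i) (vec_mx x 1 i) (vec_mx x 2 i) (vec_mx x 3 i).

Lemma cV_of_real_surj n (v : 'cV[H]_n) : exists x, cV_of_real x = v.
Proof.
exists (mxvec (\matrix_(c < 4, i < n) [:: q0 (v i 0); q1 (v i 0); q2 (v i 0); q3 (v i 0)]`_c)).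
by apply/matrixP => i j; rewrite !ord1 mxE mxvecK !mxE /=; case: (v i 0).
Qed.

Lemma cV_of_real_continuous n i j : quat_continuous (fun x => @cV_of_real n x i j).
Proof.
have E (g : H -> R) c : (forall x, g (@cV_of_real n x i j) = x 0 (mxvec_index c i)) ->
    continuous (fun x => g (@cV_of_real n x i j)).
  by move/funext ->; exact: coord_continuous.
by split; [apply: (E _ 0) | apply: (E _ 1) | apply: (E _ 2) | apply: (E _ 3)] => x;
  rewrite !mxE.
Qed.

Lemma frmx_cV_of_real_continuous m n (Z : 'M[H]_(m, n)) :
  continuous (fun x => frmx (Z *m cV_of_real x)).
Proof.
apply: continuous_sum => i; apply: continuous_sum => j; apply: qnorm2_continuous.
under [X in quat_continuous X]funext do rewrite mxE.
apply: quat_continuous_sum => k; apply: quat_continuous_mull.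
exact: cV_of_real_continuous.
Qed.

(** The maximum is attained on the unit sphere, nonempty since the dimension is positive. Scaling a
    nonzero y to unit length gives the homogeneous bound for every y. *)
Lemma ex_max_stretch m n (Z : 'M[H]_(m, n.+1)) :
  exists2 v : 'cV[H]_n.+1, frmx v = 1 &
    forall y : 'cV[H]_n.+1, frmx (Z *m y) <= frmx (Z *m v) * frmx y.
Proof.
pose S : set 'rV[R]_(4 * n.+1) := [set x | frmx (cV_of_real x) = 1]%classic.
have cfr : continuous (fun x : 'rV[R]_(4 * n.+1) => frmx (cV_of_real x)).
  rewrite (_ : (fun x => _) = fun x => frmx (1%:M *m cV_of_real x)).
    exact: frmx_cV_of_real_continuous.
  by apply/funext => x; rewrite mul1mx.
have cS : closed S.
  exact: (closed_comp (fun x _ => cfr x) (@closed_eq _ 1)).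
(* The norm on real row vectors is the maximum of the absolute values of the entries, and the square
   of each entry is one of the nonnegative terms summing to 1. *)
have bS : bounded_set S.
  exists 1; split => // M M1 x Sx.
  rewrite /Num.norm /= mx_normrE; apply/bigmax_leP; split; first by rewrite (le_trans _ (ltW M1)).
  move=> [i k] _ /=; rewrite !ord1 {i}.
  apply: le_trans (ltW M1).
  case/mxvec_indexP: k => c i.
  have xi : qnorm2 (cV_of_real x i 0) <= 1.
    rewrite -Sx /frmx /ipmx (bigD1 i) //= big_ord1 lerDl.
    by apply: sumr_ge0 => k _; rewrite big_ord1; exact: qnorm2_ge0.
  have x1 : x 0 (mxvec_index c i) ^+ 2 <= 1.
    apply: le_trans xi; rewrite /qnorm2 /qdot !mxE /= -!expr2.
    have s0 (a : R) := sqr_ge0 a.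
    have [->|->|->|->] : [\/ c = 0, c = 1, c = 2 | c = 3].
      case: c => [[|[|[|[|//]]]] ?]; [constructor 1|constructor 2|constructor 3|constructor 4];
        exact: val_inj.
    - by rewrite -!addrA lerDl !addr_ge0.
    - by rewrite -!addrA addrCA lerDl !addr_ge0.
    - by rewrite addrAC lerDr !addr_ge0.
    - by rewrite lerDr !addr_ge0.
  by rewrite -(@ler_sqr _ _ 1) ?nnegrE ?normr_ge0 // expr1n real_normK // num_real.
have S0 : (S !=set0)%classic.
  have [x xE] := cV_of_real_surj (delta_mx 0 0 : 'cV[H]_n.+1).
  by exists x; rewrite /S /= xE frmx_delta.
have [x Sx xmax] := @EVT_max_rV R _ _ S S0 (bounded_closed_compact bS cS)
  (continuous_subspaceT (@frmx_cV_of_real_continuous _ _ Z)).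
exists (cV_of_real x); first by move: Sx; rewrite inE.
move=> y; case: (eqVneq (frmx y) 0) => [/[dup] /frmx_eq0 -> ->|y0].
  by rewrite mulmx0 frmx0 mulr0.
have ygt0 : 0 < frmx y by rewrite lt_def y0 frmx_ge0.
pose c := (Num.sqrt (frmx y))^-1.
have c2 : c ^+ 2 = (frmx y)^-1 by rewrite exprVn sqr_sqrtr // frmx_ge0.
have [x' x'E] := cV_of_real_surj (qofr c *: y).
have := xmax x'; rewrite inE /S /= x'E frmx_real_scale c2 mulVf // => /(_ erefl).
by rewrite scale_qofr_mulr frmx_real_scale c2 mulrC ler_pdivrMr.
Qed.

End MaximalStretch.

(** * Existence of a quaternion SVD by recursion on the number of columns *)

Section SVD.
Variable R : realType.
Local Notation H := (quat R).

(** When x = 0 any unit vector serves, so the recursion needs no separate treatment of Z v = 0. *)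
Lemma ex_unit_scale m (x : 'cV[H]_m.+1) :
  exists2 u : 'cV[H]_m.+1, frmx u = 1 & x = qofr (Num.sqrt (frmx x)) *: u.
Proof.
case: (eqVneq (frmx x) 0) => [x0|x0].
  exists (delta_mx 0 0); first exact: frmx_delta.
  by rewrite (frmx_eq0 x0) frmx0 sqrtr0 raddf0 scale0r.
have s0 : Num.sqrt (frmx x) != 0 by rewrite sqrtr_eq0 -ltNge lt_def x0 frmx_ge0.
exists (qofr (Num.sqrt (frmx x))^-1 *: x).
  by rewrite frmx_real_scale exprVn sqr_sqrtr ?frmx_ge0 // mulVf.
by rewrite scalerA -rmorphM mulfV // rmorph1 scale1r.
Qed.

(** The first column is given; maximality of the stretch removes the rest of the first row. The
    bound inherited by [B] later puts [sg] above the singular values of [B]. *)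
Lemma block_stretch m n (sg : R) (A : 'M[H]_(1 + m, 1 + n)) :
  A *m (delta_mx 0 0 : 'cV_(1 + n)) = qofr sg *: (delta_mx 0 0 : 'cV_(1 + m)) ->
  (forall y : 'cV_(1 + n), frmx (A *m y) <= sg ^+ 2 * frmx y) ->
  exists2 B : 'M[H]_(m, n), A = block_mx (qofr sg)%:M 0 0 B &
    forall y : 'cV_n, frmx (B *m y) <= sg ^+ 2 * frmx y.
Proof.
rewrite -[A]submxK; set w := ursubmx A; set B := drsubmx A.
rewrite !delta_mx_col0 mul_block_col !mulmx1 !mulmx0 !addr0 scale_col_mx scaler0.
rewrite scalemx1 => /eq_col_mx[-> ->] bound.
have fw0 : frmx w = 0.
  have := bound (col_mx (qofr sg)%:M (adjmx w)).
  rewrite mul_block_col mul0mx add0r !frmx_col mul_adjmx_rV -scalar_mxM -raddfD.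
  rewrite -rmorphM -raddfD !frmx_scalar1 !qnorm2_ofr frmx_adj.
  have := frmx_ge0 w; have := frmx_ge0 (B *m adjmx w).
  set b := frmx (B *m _); set a := frmx w => b0 a0 ab.
  have s0 := sqr_ge0 sg.
  apply/eqP; rewrite eq_le a0 andbT leNgt; apply/negP => a1.
  have : 0 < a * a by rewrite mulr_gt0.
  have : 0 <= a * sg ^+ 2 by rewrite mulr_ge0.
  move: ab; rewrite expr2 => *; nra.
rewrite (frmx_eq0 fw0); exists B => // y.
have := bound (col_mx 0 y).
by rewrite mul_block_col !frmx_col (frmx_eq0 fw0) mul0mx !mulmx0 !addr0 frmx0 !add0r.
Qed.

Lemma mulmx_diagq_delta m n (le_nm : (n <= m)%N) (s : 'rV[R]_n) j :
  diagq m s *m delta_mx j 0 = qofr (s 0 j) *: delta_mx (widen_ord le_nm j) 0 :> 'cV[H]_m.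
Proof.
apply/matrixP => i k; rewrite !ord1 mxE (bigD1 j) //= big1 => [|l lj].
  by rewrite (diagqE le_nm) !mxE !eqxx addr0 andbT; case: (i == _); rewrite ?mulr1 ?mulr0 ?mul0r.
by rewrite !mxE (negPf lj) mulr0.
Qed.

Lemma diagq_row_mx m n (a : R) (s : 'rV[R]_n) :
  diagq (1 + m) (row_mx a%:M s) = block_mx (qofr a)%:M 0 0 (diagq m s) :> 'M[H]_(1 + m, 1 + n).
Proof.
apply/matrixP => i j; rewrite mxE.
case: (split_ordP i) => i' ->; case: (split_ordP j) => j' ->;
  rewrite ?block_mxEul ?block_mxEur ?block_mxEdl ?block_mxEdr ?row_mxEl ?row_mxEr ?ord1 !mxE //=.
Qed.

Lemma quat_svd n m (Z : 'M[H]_(m, n)) : (n <= m)%N ->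
  exists U V s, [/\ unimx U, unimx V, sdesc s & Z = U *m diagq m s *m adjmx V].
Proof.
elim: n m Z => [|n IH] m Z le_nm.
  exists 1%:M, 1%:M, 0; split; try exact: unimx1; first by split=> [[]|[]].
  by apply/matrixP => i [].
case: m => // m in Z le_nm *.
have [v v1 vmax] := ex_max_stretch Z.
have [u u1 Zv] := ex_unit_scale (Z *m v); set sg := Num.sqrt _ in Zv.
have sg2 : sg ^+ 2 = frmx (Z *m v) by rewrite sqr_sqrtr ?frmx_ge0.
have [P uP Pv] := unimx_with_col0 v1; have [Q uQ Qu] := unimx_with_col0 u1.
have Adelta : adjmx Q *m Z *m P *m delta_mx 0 0 = qofr sg *: (delta_mx 0 0 : 'cV_m.+1).
  rewrite -mulmxA Pv -mulmxA Zv -Qu scale_qofr_mulr mulmxA.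
  by case: uQ => _ ->; rewrite mul1mx.
have [||B AB Bb] := @block_stretch m n sg (adjmx Q *m Z *m P).
- exact: Adelta.
- move=> y; rewrite -!mulmxA (frmx_mull _ (unimx_adj uQ)) sg2.
  by rewrite -(frmx_mull y uP).
have [U2 [V2 [s2 [uU2 uV2 [s2d s20] B2]]]] := IH m B le_nm.
have s2sg j : s2 0 j <= sg.
  rewrite -ler_sqr ?nnegrE ?sqrtr_ge0 //.
  (* The j-th right singular vector of [B] is a unit vector whose image has squared norm s2_j^2. *)
  have := Bb (V2 *m delta_mx j 0).
  rewrite frmx_mull // frmx_delta mulr1 B2 -mulmxA (mulmxA (adjmx V2)).
  case: (uV2) => _ ->; rewrite mul1mx -mulmxA frmx_mull //.
  by rewrite (mulmx_diagq_delta (le_nm : (n <= m)%N)) frmx_real_scale frmx_delta mulr1.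
exists (Q *m (block_mx (1%:M : 'M_1) 0 0 U2 : 'M_(1 + m))),
  (P *m (block_mx (1%:M : 'M_1) 0 0 V2 : 'M_(1 + n))),
  (row_mx sg%:M s2 : 'rV_(1 + n)).
split.
- by apply: unimxM => //; apply: (@unimx_block _ 1 m) => //; exact: unimx1.
- by apply: unimxM => //; apply: (@unimx_block _ 1 n) => //; exact: unimx1.
- have rE : forall i : 'I_(1 + n), 0 <= (row_mx sg%:M s2 : 'rV_(1 + n)) 0 i.
    move=> i; case: (split_ordP i) => k ->; rewrite ?row_mxEl ?row_mxEr //.
    by rewrite ord1 mxE sqrtr_ge0.
  split=> // i j; case: (@split_ordP 1 n i) => i' ->; case: (@split_ordP 1 n j) => j' ->;
    rewrite ?(@row_mxEl _ 1 1 n) ?(@row_mxEr _ 1 1 n) ?ord1 //= ?mxE //.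
  by rewrite !add1n ltnS; exact: s2d.
rewrite adjmxM (@diagq_row_mx m n) (@adjmx_block _ 1 n 1 n).
rewrite !adjmx0 adjmx1 !mulmxA -(mulmxA Q) (@mulmx_block _ 1 m 1 m 1 n).
rewrite -(mulmxA Q) (@mulmx_block _ 1 m 1 n 1 n).
rewrite !mulmx0 !mul0mx !mulmx1 !mul1mx !addr0 !add0r -B2 !mul0mx -AB.
rewrite !mulmxA; case: (uQ) => -> _; rewrite mul1mx -mulmxA.
by case: (uP) => -> _; rewrite mulmx1.
Qed.

End SVD.

(** * Transfer between four-component records and matrices over the quaternion ring *)

Section Encoding.
Variable R : realType.
Local Notation H := (quat R).

Definition qmat m n (A : qmx R m n) : 'M[H]_(m, n) :=
  \matrix_(i, j) Quat (qr A i j) (qi A i j) (qj A i j) (qk A i j).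
Definition matq m n (A : 'M[H]_(m, n)) : qmx R m n :=
  QMx (map_mx (@q0 R) A) (map_mx (@q1 R) A) (map_mx (@q2 R) A) (map_mx (@q3 R) A).

Lemma matqK m n : cancel (@matq m n) (@qmat m n).
Proof. by move=> A; apply/matrixP => i j; rewrite !mxE; case: (A i j). Qed.

Lemma qmatK m n : cancel (@qmat m n) (@matq m n).
Proof. by case=> a b c d; rewrite /matq; congr QMx; apply/matrixP => i j; rewrite !mxE. Qed.

Lemma qmat_mul m n p (A : qmx R m n) (B : qmx R n p) :
  qmat (qmul A B) = qmat A *m qmat B.
Proof.
apply/matrixP => i j; rewrite !mxE; apply: quatP;
  rewrite [RHS]raddf_sum [LHS]/= -?sumrN -?big_split /= -?big_split /= -?big_split /=;
  by apply: eq_bigr => k _; rewrite !mxE.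
Qed.

Lemma qmat_adj m n (A : qmx R m n) : qmat (qadj A) = adjmx (qmat A).
Proof. by apply/matrixP => i j; rewrite !mxE. Qed.

Lemma qmat_sub m n (A B : qmx R m n) : qmat (qsub A B) = qmat A - qmat B.
Proof. by apply/matrixP => i j; rewrite !mxE. Qed.

Lemma qmat_id n : qmat (qid R n) = 1%:M.
Proof. by apply/matrixP => i j; rewrite !mxE; case: (i == j). Qed.

Lemma qmat_zero m n : qmat (qzero R m n) = 0.
Proof. by apply/matrixP => i j; rewrite !mxE. Qed.

Lemma qmat_diag m n (s : 'rV[R]_n) : qmat (qreal (diagmn m s)) = diagq m s.
Proof. by apply/matrixP => i j; rewrite !mxE; case: ifP. Qed.

Lemma qmat_unitary n (U : qmx R n n) : qunitary U <-> unimx (qmat U).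
Proof.
rewrite /qunitary /unimx -qmat_adj -!qmat_mul -qmat_id.
by split=> [[-> ->]|[/(can_inj (@qmatK _ _)) -> /(can_inj (@qmatK _ _)) ->]].
Qed.

Lemma qfrobE m n (A : qmx R m n) : qfrob A = Num.sqrt (frmx (qmat A)).
Proof.
congr Num.sqrt; apply: eq_bigr => i _; apply: eq_bigr => j _.
by rewrite mxE /qdot /= !expr2.
Qed.

Lemma qfrob2 m n (A : qmx R m n) : qfrob A ^+ 2 = frmx (qmat A).
Proof. by rewrite qfrobE sqr_sqrtr // frmx_ge0. Qed.

Lemma qsvdP m n (X : qmx R m n) U s V : (n <= m)%N ->
  qsvd X U s V <-> [/\ unimx (qmat U), unimx (qmat V), sdesc s &
    qmat X = qmat U *m diagq m s *m adjmx (qmat V)].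
Proof.
move=> le_nm; rewrite /qsvd -qmat_adj -qmat_diag -!qmat_mul.
split=> [[/qmat_unitary uU /qmat_unitary uV sd _ ->]|]; first by split.
case=> /qmat_unitary uU /qmat_unitary uV sd /(can_inj (@qmatK _ _)) ->; split => // j mj.
by have := leq_trans (ltn_ord j) (leq_trans le_nm mj); rewrite ltnn.
Qed.

(** As [qsvals] is picked by [epsilon], it is known to list singular values only once some SVD
    exists; the existence result enters here. *)
Lemma qsvals_svd m n (X : qmx R m n) : (n <= m)%N -> exists U V, qsvd X U (qsvals X) V.
Proof.
move=> le_nm; apply: (epsilon_spec (inhabits 0) (fun s => exists U V, qsvd X U s V)).
have [U [V [s [uU uV sd E]]]] := quat_svd (qmat X) le_nm.
by exists s, (matq U), (matq V); apply/(qsvdP _ _ _ _ le_nm); rewrite !matqK.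
Qed.

Lemma frmx_svd m n (U : 'M[H]_m) (s : 'rV[R]_n) (V : 'M[H]_n) : (n <= m)%N ->
  unimx U -> unimx V -> frmx (U *m diagq m s *m adjmx V) = \sum_j s 0 j ^+ 2.
Proof.
move=> le_nm uU uV.
by rewrite (frmx_mulr _ (unimx_adj uV)) (frmx_mull _ uU) (frmx_diag le_nm).
Qed.

(* Applying the trace inequality to X and U' I V'^*, where X = U' S' V'^* is another SVD,
   bounds the sum of the singular values in S' without proving their uniqueness. *)
Lemma qnuc_le m n (X : qmx R m n) U s V : (n <= m)%N -> qsvd X U s V ->
  qnuc X <= \sum_j s 0 j.
Proof.
move=> le_nm /(qsvdP _ _ _ _ le_nm)[uU uV [sd s0] XE].
have [U' [V' /(qsvdP _ _ _ _ le_nm)[uU' uV' _ XE']]] := qsvals_svd X le_nm.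
have := @von_neumann_le _ m n (qmat U') (qmat V') (qmat U) (qmat V) (const_mx 1) s
  le_nm uU' uV' uU uV.
rewrite -XE XE' ipmx_mulr ipmx_mull adjmxK.
have -> : adjmx (qmat U') *m (qmat U' *m diagq m (qsvals X) *m adjmx (qmat V') *m qmat V')
    = diagq m (qsvals X).
  rewrite -!mulmxA; case: uV' => _ ->; rewrite mulmx1 mulmxA.
  by case: uU' => _ ->; rewrite mul1mx.
rewrite (ipmx_diag le_nm).
under eq_bigr do rewrite mxE mul1r (diagqE le_nm) eqxx.
under [X in _ -> _ -> _ -> _ -> _ <= X]eq_bigr do rewrite mxE mul1r.
by apply=> // [i j _|i]; rewrite !mxE.
Qed.

(** The penalties agree, since [qsvals Z] comes from an SVD of [Z]. After expanding the squares only
    the cross terms differ, and the trace inequality compares them. *)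
Lemma vobj_le_qobj m n (Y : qmx R m n) lam U sY V Z : (n <= m)%N -> qsvd Y U sY V ->
  vobj sY lam (qsvals Z) <= qobj Y lam Z.
Proof.
move=> le_nm /(qsvdP _ _ _ _ le_nm)[uU uV [yd y0] YE].
have [U' [V' /(qsvdP _ _ _ _ le_nm)[uU' uV' [td t0] ZE]]] := qsvals_svd Z le_nm.
rewrite /vobj /qobj /qnuc qfrob2 qfrobE qmat_sub frmxB YE ZE !frmx_svd //.
set t := qsvals Z in td t0 *.
have vn := von_neumann_le le_nm uU uV uU' uV' yd y0 td t0.
have -> : \sum_j `|t 0 j| = \sum_j t 0 j by apply: eq_bigr => j _; rewrite ger0_norm.
rewrite lerD2r ler_wpM2l ?invr_ge0 //.
have -> : \sum_j (sY 0 j - t 0 j) ^+ 2 =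
    \sum_j sY 0 j ^+ 2 - 2 * (\sum_j sY 0 j * t 0 j) + \sum_j t 0 j ^+ 2.
  rewrite mulr_sumr -sumrB -big_split; apply: eq_bigr => j _ /=; ring.
by rewrite lerD2r lerD2l lerN2 ler_wpM2l.
Qed.

End Encoding.

(** * Optimality of the matrix built from a solution of the vector problem *)

Theorem theorem3p5 (R : realType) (m n : nat) (Y : qmx R m n) (lam : R)
    (U : qmx R m m) (sY : 'rV[R]_n) (V : qmx R n n) (s : 'rV[R]_n) :
  (n <= m)%N -> 0 < lam -> qsvd Y U sY V ->
  (sdesc s /\ s != 0 /\
     forall t : 'rV[R]_n, sdesc t -> t != 0 -> vobj sY lam s <= vobj sY lam t) ->
  let X := qmul (qmul U (qreal (diagmn m s))) (qadj V) in
  X <> qzero R m n /\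
  forall Z : qmx R m n, Z <> qzero R m n -> qobj Y lam X <= qobj Y lam Z.
Proof.
move=> le_nm lam0 svdY [sd [s0 smin]] X.
have [uU uV _ YE] := (qsvdP _ _ _ _ le_nm).1 svdY.
have XE : qmat X = qmat U *m diagq m s *m adjmx (qmat V).
  rewrite /X (qmat_mul (qmul U _)) (qmat_mul U) qmat_diag qmat_adj.
  reflexivity.
have svdX : qsvd X U s V by apply/(qsvdP _ _ _ _ le_nm).
have fX : frmx (qmat X) = \sum_j s 0 j ^+ 2 by rewrite XE frmx_svd.
split=> [X0|Z Z0].
  move: fX; rewrite X0 qmat_zero frmx0 => /esym/eqP.
  rewrite psumr_eq0 => [/allP s2|j _]; last exact: sqr_ge0.
  case/eqP: s0; apply/rowP => j; rewrite mxE; apply/eqP.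
  by rewrite -sqrf_eq0; exact: (s2 j (mem_index_enum _)).
have [U' [V' /(qsvdP _ _ _ _ le_nm)[_ _ td ZE]]] := qsvals_svd Z le_nm.
(* A nonzero [Z] has a nonzero vector of singular values, which is thus a legitimate competitor in
   the vector problem. *)
have t0 : qsvals Z != 0.
  apply/eqP => t0; apply: Z0; rewrite -[Z]qmatK -[qzero _ _ _]qmatK ZE qmat_zero t0.
  rewrite (_ : diagq m 0 = 0) ?mulmx0 ?mul0mx //.
  by apply/matrixP => i j; rewrite !mxE raddf0 if_same.
apply: le_trans (vobj_le_qobj lam Z le_nm svdY).
apply: le_trans (smin _ td t0).
(* [X] and [Y] share [U] and [V], so the fidelity terms and the Frobenius norms match exactly. For
   the nuclear norm an upper bound by the sum of [s] suffices, because [lam] is positive. *)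
rewrite /qobj /vobj qfrob2 qfrobE fX qmat_sub XE YE -mulmxBl -mulmxBr -diagqB frmx_svd //.
have -> : \sum_j `|s 0 j| = \sum_j s 0 j.
  by apply: eq_bigr => j _; rewrite ger0_norm //; exact: sd.2.
under eq_bigr do rewrite !mxE.
rewrite lerD2l ler_wpM2l ?(ltW lam0) // ler_wpM2r ?invr_ge0 ?sqrtr_ge0 //.
exact: qnuc_le svdX.
Qed.
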